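(* Let $X:\Omega\to C([0,2])$ be a centered Gaussian random variable with covariance kernel $k_X(t,s)=\kappa(t-s)$, $t,s\in[0,2]$, where $\kappa:[-2,2]\to\mathbb{R}$, $\kappa(t)=e^{-t^2}$. Let $I=[0,1/2]$, $Y:=X|_I$, and let $M_W:W_Y\to W_X$ be the minimal-norm extension operator. Then every linear operator $M:C(I)\to C([0,2])$ that extends $M_W$ (i.e. $Mf=M_Wf$ for all $f\in W_Y$) satisfies $$\|M\|_{C(I)\to C([0,2])}\ \ge\ 4e^{-3/4}\ >\ 1,$$ where both spaces carry the supremum norm. Consequently, the following assertion fails for this $\kappa$ and this $I$: there exists a linear operator $M:C(I)\to C([0,2])$ with $MY=\mathbb{E}(X\mid Y)$ and $\|M\|_{C(I)\to C([0,2])}\le1$.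
   Context: $C([0,2])$ and $C(I)$ are the spaces of real-valued continuous functions with the supremum norm. A random variable with values in a separable Banach space $E$ is Gaussian if every $e'\in E'$ maps it to a real Gaussian random variable; $k_X(t,s)=\mathbb{E}[X(t)X(s)]$. $W_X$ denotes the reproducing kernel Hilbert space of real-valued functions on $[0,2]$ with kernel $k_X$, and $W_Y$ the one on $I$ with kernel $k_X|_{I\times I}$. The minimal-norm extension operator $M_W:W_Y\to W_X$ sends $g$ to the unique element of minimal $W_X$-norm among all $f\in W_X$ with $f|_I=g$. $\mathbb{E}(X\mid Y)$ is the (Bochner) conditional expectation of $X$ given the $\sigma$-algebra generated by $Y$. The operator norm of an unbounded operator is understood as $+\infty$. *)

(* Defs.v *)
From HB Require Import structures.
From mathcomp Require Import all_boot all_order all_algebra.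
From mathcomp Require Import all_classical all_reals all_analysis.

Set Implicit Arguments.
Unset Strict Implicit.
Unset Printing Implicit Defensive.

Import Order.TTheory GRing.Theory Num.Theory.
Import numFieldNormedType.Exports.

Local Open Scope classical_set_scope.
Local Open Scope ring_scope.

Notation seg a b := (set_type [set` `[a, b]]).

Section ContinuousFunctions.
Context {R : realType} (a b : R).

Definition Cseg : Type := continuousType (seg a b) R.

HB.instance Definition _ := Choice.on Cseg.

Definition Cseg_fun (f : Cseg) : seg a b -> R := f.

Lemma Cseg_continuous (f : Cseg) : continuous (Cseg_fun f).
Proof. exact: cts_fun. Qed.

Definition mkCseg (f : seg a b -> R) (cf : continuous f) : Cseg := mkcts cf.

Lemma CsegP (f g : Cseg) : Cseg_fun f =1 Cseg_fun g -> f = g.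
Proof. by move=> fg; apply/continuousEP. Qed.

Let add_cts (f g : Cseg) : continuous (fun x => Cseg_fun f x + Cseg_fun g x).
Proof. by move=> x; exact: (cvgD (@Cseg_continuous f x) (@Cseg_continuous g x)). Qed.

Let opp_cts (f : Cseg) : continuous (fun x => - Cseg_fun f x).
Proof. by move=> x; exact: (cvgN (@Cseg_continuous f x)). Qed.

Let scale_cts (k : R) (f : Cseg) : continuous (fun x => k * Cseg_fun f x).
Proof.
by move=> x; exact: (cvgM (cvg_cst k) (@Cseg_continuous f x)).
Qed.

Let zero_cts : continuous (fun _ : seg a b => 0 : R).
Proof. exact: cst_continuous. Qed.

Definition Cseg0 : Cseg := mkCseg (@zero_cts).
Definition Cseg_add (f g : Cseg) : Cseg := mkCseg (@add_cts f g).
Definition Cseg_opp (f : Cseg) : Cseg := mkCseg (@opp_cts f).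
Definition Cseg_scale (k : R) (f : Cseg) : Cseg := mkCseg (@scale_cts k f).

Let addA : associative Cseg_add.
Proof. by move=> f g h; apply: CsegP => x; exact: addrA. Qed.
Let addC : commutative Cseg_add.
Proof. by move=> f g; apply: CsegP => x; exact: addrC. Qed.
Let add0 : left_id Cseg0 Cseg_add.
Proof. by move=> f; apply: CsegP => x; exact: add0r. Qed.
Let addN : left_inverse Cseg0 Cseg_opp Cseg_add.
Proof. by move=> f; apply: CsegP => x; exact: addNr. Qed.

HB.instance Definition _ := GRing.isZmodule.Build Cseg addA addC add0 addN.

Let scaleA k l f : Cseg_scale k (Cseg_scale l f) = Cseg_scale (k * l) f.
Proof. by apply: CsegP => x; exact: mulrA. Qed.
Let scale1 : left_id 1 Cseg_scale.
Proof. by move=> f; apply: CsegP => x; exact: mul1r. Qed.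
Let scaleDr : right_distributive Cseg_scale +%R.
Proof. by move=> k f g; apply: CsegP => x; exact: mulrDr. Qed.
Let scaleDl f : {morph Cseg_scale^~ f : k l / k + l}.
Proof. by move=> k l; apply: CsegP => x; exact: mulrDl. Qed.

HB.instance Definition _ :=
  GRing.Zmodule_isLmodule.Build R Cseg scaleA scale1 scaleDr scaleDl.

Definition supnorm (f : Cseg) : R := sup (range (fun x => `|Cseg_fun f x|)).

Lemma Cseg_bounded (f : Cseg) : has_ubound (range (fun x => `|Cseg_fun f x|)).
Proof.
pose g : R -> R := valL_ 0 (Cseg_fun f).
have gf : sigL `[a, b] g = Cseg_fun f by exact: valLK.
have cg : {within `[a, b], continuous g}.
  by apply/subspace_sigL_continuousP; rewrite gf; exact: Cseg_continuous.
have [M [_ Mg]] := compact_bounded (continuous_compact cg (@segment_compact R a b)).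
exists (M + 1) => _ [x _ <-]; rewrite -gf.
apply: (Mg (M + 1)); first by rewrite ltrDl.
by exists (\val x) => //; exact: set_valP.
Qed.

Lemma supnorm_ub (f : Cseg) x : `|Cseg_fun f x| <= supnorm f.
Proof. by apply: ub_le_sup; [exact: Cseg_bounded|exists x]. Qed.

Lemma supnorm_le (f : Cseg) (M : R) : 0 <= M ->
  (forall x, `|Cseg_fun f x| <= M) -> supnorm f <= M.
Proof.
move=> M0 fM; rewrite /supnorm; set A := (X in sup X).
have [->|/set0P A0] := eqVneq A set0; first by rewrite sup0.
by apply: ge_sup => // _ [x _ <-].
Qed.

Lemma supnorm_ge0 (f : Cseg) : 0 <= supnorm f.
Proof.
rewrite /supnorm; set A := (X in sup X).
have [->|/set0P[_ [x _ _]]] := eqVneq A set0; first by rewrite sup0.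
exact: le_trans (supnorm_ub f x).
Qed.

Let supnormD (f g : Cseg) : supnorm (f + g) <= supnorm f + supnorm g.
Proof.
apply: supnorm_le => [|x]; first by rewrite addr_ge0// supnorm_ge0.
by rewrite (le_trans (ler_normD _ _))// lerD// supnorm_ub.
Qed.

Let supnormZ_le (k : R) (f : Cseg) : supnorm (k *: f) <= `|k| * supnorm f.
Proof.
apply: supnorm_le => [|x]; first by rewrite mulr_ge0// supnorm_ge0.
by rewrite [Cseg_fun _ _]/(k * Cseg_fun f x) normrM ler_wpM2l// supnorm_ub.
Qed.

Let supnormZ (k : R) (f : Cseg) : supnorm (k *: f) = `|k| * supnorm f.
Proof.
apply/eqP; rewrite eq_le supnormZ_le /=.
have [->|k0] := eqVneq k 0; first by rewrite normr0 mul0r supnorm_ge0.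
rewrite -ler_pdivlMl ?normr_gt0// -normfV.
rewrite -[in leLHS](scalerK k0 f); exact: supnormZ_le.
Qed.

Let supnorm0_eq0 (f : Cseg) : supnorm f = 0 -> f = 0.
Proof.
move=> f0; apply: CsegP => x; apply/eqP; rewrite -normr_le0 -f0.
exact: supnorm_ub.
Qed.

HB.instance Definition _ :=
  Lmodule_isNormed.Build R Cseg supnormD supnormZ supnorm0_eq0.

Lemma Cseg_normE (f : Cseg) : `|f| = sup (range (fun x => `|Cseg_fun f x|)).
Proof. by []. Qed.

End ContinuousFunctions.

Coercion Cseg_fun : Cseg >-> Funclass.

Section Restriction.
Context {R : realType} (a b c d : R) (ca : c <= a) (bd : b <= d).

Lemma seg_incl_subproof (x : seg a b) : \val x \in [set` `[c, d]].
Proof.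
have := set_valP x; rewrite /= !in_itv /= => /andP[ax xb].
by rewrite inE /= in_itv /= (le_trans ca ax) (le_trans xb bd).
Qed.

Definition seg_incl (x : seg a b) : seg c d :=
  exist _ (\val x) (seg_incl_subproof x).

Lemma seg_incl_continuous : continuous seg_incl.
Proof.
by apply: continuous_comp_initial; exact: initial_continuous.
Qed.

Lemma restr_subproof (f : Cseg c d) : continuous (f \o seg_incl).
Proof.
move=> x; apply: continuous_comp; first exact: seg_incl_continuous.
exact: Cseg_continuous.
Qed.

Definition restr (f : Cseg c d) : Cseg a b := mkCseg (@restr_subproof f).

End Restriction.

Section Operators.
Context {R : realType} {E F : normedModType R}.

(* In the extended reals, hence +oo when M is unbounded. *)
Definition opnorm (M : {linear E -> F}) : \bar R :=
  ereal_sup [set `|M f|%:E | f in [set f : E | `|f| <= 1]].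

End Operators.

Notation borel E := (g_sigma_algebraType (@open E)).

Section BanachRandomVariables.
Context {R : realType} {d : measure_display} {Omega : measurableType d}.
Context (P : probability Omega R) {E : normedModType R}.

Definition random_element (X : Omega -> E) :=
  measurable_fun [set: Omega] (X : Omega -> borel E).

(* Point masses are the degenerate Gaussian laws; normal_prob m 0 is not one. *)
Definition gaussian_rv (x : Omega -> R) :=
  measurable_fun [set: Omega] x /\
  exists m s : R, 0 <= s /\
    forall A : set R, measurable A ->
      P (x @^-1` A) = if s == 0 then \d_m A else normal_prob m s A.

Definition gaussian (X : Omega -> E) :=
  random_element X /\
  forall e : {linear E -> R^o}, continuous e -> gaussian_rv (e \o X).

Definition simple_element (s : Omega -> E) :=
  finite_set (range s) /\ forall y : E, measurable (s @^-1` [set y]).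

Definition simple_integral (A : set Omega) (s : Omega -> E) : E :=
  \sum_(y \in range s) fine (P (A `&` s @^-1` [set y])) *: y.

(* f is Bochner integrable over A, with integral v. *)
Definition has_bochner_integral (A : set Omega) (f : Omega -> E) (v : E) :=
  random_element f /\
  exists s : nat -> Omega -> E,
    [/\ forall n, simple_element (s n),
        (\int[P]_(w in A) `|f w - s n w|%:E)%E @[n --> \oo] --> 0%E &
        simple_integral A (s n) @[n --> \oo] --> v].

Definition centered (X : Omega -> E) := has_bochner_integral [set: Omega] X 0.

End BanachRandomVariables.

Section ConditionalExpectation.
Context {R : realType} {d : measure_display} {Omega : measurableType d}.
Context (P : probability Omega R) {E F : normedModType R}.

Definition sigma_gen (Y : Omega -> F) : set (set Omega) :=
  g_sigma_algebra_preimage (Y : Omega -> borel F).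

(* Z is a version of E(X | Y). *)
Definition is_cond_exp (X : Omega -> E) (Y : Omega -> F) (Z : Omega -> E) :=
  (forall B : set (borel E), measurable B -> sigma_gen Y (Z @^-1` B)) /\
  forall A, sigma_gen Y A ->
    exists v : E, has_bochner_integral P A X v /\ has_bochner_integral P A Z v.

End ConditionalExpectation.

(* Hilbert space of functions T -> R with reproducing kernel k: the space is an
   abstract Hilbert space, realized as functions through the linear injection
   rkhs_fun. *)
Record rkhs {R : realType} {T : Type} (k : T -> T -> R) : Type := Rkhs {
  rkhs_space :> completeNormedModType R;
  rkhs_dot : {dot rkhs_space for idfun};
  rkhs_normE : forall f, rkhs_dot f f = `|f| ^+ 2;
  rkhs_fun : {linear rkhs_space -> (T -> R^o)};
  rkhs_fun_inj : injective rkhs_fun;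
  rkhs_section : T -> rkhs_space;
  rkhs_sectionE : forall t s, rkhs_fun (rkhs_section t) s = k s t;
  rkhs_reproducing : forall f t, rkhs_fun f t = rkhs_dot f (rkhs_section t) }.

Section MinimalNormExtension.
Context {R : realType} {T S : Type} (i : S -> T) {k : T -> T -> R}.
Context (WX : rkhs k) (WY : rkhs (fun t s => k (i t) (i s))).

Definition is_extension (g : WY) (f : WX) :=
  rkhs_fun WX f \o i = rkhs_fun WY g.

Definition is_min_norm_extension (g : WY) (f : WX) :=
  is_extension g f /\ forall h : WX, is_extension g h -> `|f| <= `|h|.

(* The set is a singleton for every g : WY (projection theorem), so the default
   0 is never used. *)
Definition min_norm_extension (g : WY) : WX :=
  xget 0 [set f | is_min_norm_extension g f].

End MinimalNormExtension.
Arguments min_norm_extension {R T S} i {k} WX WY g.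

Definition cov_kernel {R : realType} {d : measure_display}
    {Omega : measurableType d} (P : probability Omega R) {a b : R}
    (X : Omega -> Cseg a b) (t s : seg a b) : R :=
  \int[P]_w (X w t * X w s).

Definition kappa {R : realType} (t : R) : R := expR (- t ^+ 2).

Lemma half_le2 {R : realType} : 1 / 2 <= 2 :> R.
Proof. by rewrite ler_pdivrMr// -natrM ler1n. Qed.

Notation CI R := (Cseg (0 : R) (1 / 2)).
Notation CT R := (Cseg (0 : R) 2).
Notation inclI R := (seg_incl (lexx (0 : R)) half_le2).
Notation restrI R := (restr (lexx (0 : R)) half_le2).

(* Main.v *)
Require Import Defs.
From HB Require Import structures.
From mathcomp Require Import all_boot all_order all_algebra.
From mathcomp Require Import all_classical all_reals all_analysis.
From mathcomp Require Import measurable_realfun.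
From mathcomp Require Import ring lra.

Set Implicit Arguments.
Unset Strict Implicit.
Unset Printing Implicit Defensive.

Import Order.TTheory GRing.Theory Num.Theory.
Import numFieldNormedType.Exports.

Local Open Scope classical_set_scope.
Local Open Scope ring_scope.

(** Two facts about the centered Gaussian process X with covariance
    exp(-(t-s)^2) decide the matter. Its reproducing kernel functions satisfy
    exp(s^2) k_s(t) = exp(-t^2) exp(2st), so the combination
    k_0 - 2 exp(1/16) k_(1/4) + exp(1/4) k_(1/2) of three kernel functions with
    nodes in I = [0,1/2] is

      bump t = exp(-t^2) (exp(t/2) - 1)^2.

    Since exp(t/2) - 1 lies below its chord on I and y exp(-y) increases on
    [0,1/4], bump is at most bump (1/2) on I; but at 1 it is
    exp(-3/4) (exp(1/4) + 1)^2 times larger, hence at least 4 exp(-3/4) times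
    larger ([bump_le_half], [bump_1_ge]).

    The minimal-norm extension of a combination of kernel functions with nodes
    in I is the same combination on [0,2], because a function vanishing on I is
    orthogonal to it ([min_norm_extension_sections]). So any linear extension of
    M_W maps bump on I to bump on [0,2], which bounds its norm from below
    ([opnorm_extension_ge]).

    For the conditional expectation, let M be a linear contraction with
    M Y = E(X | Y). Bochner integrals commute with contractive functionals
    ([bochner_functional]), so v := E[1_A X] satisfies M(v|_I) = v for every A
    in the sigma-algebra of Y, and by linearity u := E[phi X] satisfies
    M(u|_I) = u for every simple function phi of Y ([fixed_moment_simple]). In
    particular the sup norm of u is attained on I. Now let phi tend in L^2 to
    V = X_0 - 2 exp(1/16) X_(1/4) + exp(1/4) X_(1/2): as X has variance 1,
    E[phi X] tends uniformly to E[V X] = bump, so that bump 1 <= bump (1/2), a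
    contradiction. Restricting to simple phi keeps the Bochner integrals E[phi X]
    defined from the integrability of X alone; V itself enters only through
    second moments of point evaluations. *)

(** * A combination of three kernel functions that grows outside I *)

(** A finite-step version of t^2 exp(-t^2), whose ratio between 1 and 1/2 is
    4 exp(-3/4): the square of exp (t/2) - 1 replaces t^2. The finite step keeps
    it in the span of kernel functions, so that no limit in the reproducing
    kernel space is needed. *)
Definition bump {R : realType} (t : R) : R :=
  expR (- t ^+ 2) * (expR (t / 2) - 1) ^+ 2.

Lemma bump_ge0 {R : realType} (t : R) : 0 <= bump t.
Proof. by rewrite mulr_ge0 ?expR_ge0 ?sqr_ge0. Qed.

Lemma bump_half_gt0 {R : realType} : 0 < bump (1 / 2 : R).
Proof.
by rewrite mulr_gt0 ?expR_gt0// exprn_gt0// subr_gt0 expR_gt1.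
Qed.

(** Convexity of exp between 0 and 1/4. *)
Lemma expRB1_chord {R : realType} (t : R) : 0 <= t <= 1 / 2 ->
  expR (t / 2) - 1 <= 2 * t * (expR (1 / 4) - 1).
Proof.
move=> /andP[t0 t12].
have t2_ge0 : 0 <= 2 * t by lra.
have t2_le1 : 2 * t <= 1 by lra.
have := convex_expR (Itv01 t2_ge0 t2_le1) (1 / 4 : R^o) (0 : R^o).
rewrite !convRE expR0 /= mulr0 addr0 mulr1 /unstable.onem.
have -> : 2 * t * (1 / 4) = t / 2 by lra.
by lra.
Qed.

(** By the chord bound, bump is at most a constant times 4 t^2 exp(-t^2); for
    y = t^2 <= 1/4 the inequality 4 y exp(-y) <= exp(-1/4) follows from
    exp(y - 1/4) >= y + 3/4 >= 4 y. *)
Lemma bump_le_half {R : realType} (t : R) : 0 <= t <= 1 / 2 ->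
  bump t <= bump (1 / 2).
Proof.
move=> tI; have /andP[t0 t12] := tI.
set a : R := expR (1 / 4) - 1.
have e14 : expR (1 / 2 / 2 : R) - 1 = a by congr (expR _ - 1); lra.
rewrite /bump e14.
have weight : expR (- t ^+ 2) * (4 * t ^+ 2) <= expR (- (1 / 2) ^+ 2).
  have -> : - (1 / 2) ^+ 2 = - t ^+ 2 + (t ^+ 2 - 1 / 4) :> R by field.
  rewrite expRD ler_wpM2l ?expR_ge0//; apply: le_trans (expR_ge1Dx _).
  nra.
have a0 : 0 <= expR (t / 2) - 1 by have := expR_ge1Dx (t / 2); lra.
have sq : (expR (t / 2) - 1) ^+ 2 <= 4 * t ^+ 2 * a ^+ 2.
  have -> : 4 * t ^+ 2 * a ^+ 2 = (2 * t * a) ^+ 2 by ring.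
  have := expRB1_chord tI; rewrite -/a => H.
  by rewrite lerXn2r// nnegrE (le_trans a0 H).
apply: le_trans (ler_wpM2l (expR_ge0 _) sq) _.
by rewrite mulrA ler_wpM2r ?sqr_ge0.
Qed.

(** With q = exp(1/4), the factor exp(1/2) - 1 = (q - 1) (q + 1) of bump 1
    exceeds the factor q - 1 of bump (1/2) by q + 1 >= 2. *)
Lemma bump_1_ge {R : realType} :
  4 * expR (- (3 / 4)) * bump (1 / 2) <= bump (1 : R).
Proof.
set q : R := expR (1 / 4); rewrite /bump.
have -> : expR (1 / 2 / 2) = q :> R by congr expR; lra.
have -> : expR (1 / 2) = q ^+ 2 :> R.
  by rewrite -expRM_natl; congr expR; lra.
have -> : expR (- 1 ^+ 2) = expR (- (3 / 4)) * expR (- (1 / 2) ^+ 2) :> R.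
  by rewrite -expRD; congr expR; rewrite !expr2; lra.
have -> : q ^+ 2 - 1 = (q - 1) * (q + 1) by ring.
have q1 : 1 <= q by have := expR_ge1Dx (1 / 4 : R); rewrite -/q; lra.
have q4 : 4 <= (q + 1) ^+ 2.
  have -> : 4 = 2 ^+ 2 :> R by ring.
  by rewrite lerXn2r// ?nnegrE; lra.
set u := expR (- (3 / 4)); set v := expR (- (1 / 2) ^+ 2).
have -> : 4 * u * (v * (q - 1) ^+ 2) = u * v * (q - 1) ^+ 2 * 4 by ring.
have -> : u * v * ((q - 1) * (q + 1)) ^+ 2 =
  u * v * (q - 1) ^+ 2 * (q + 1) ^+ 2 by ring.
by rewrite ler_wpM2l// mulr_ge0 ?sqr_ge0// mulr_ge0 ?expR_ge0.
Qed.

(** exp(-1/4) >= 3/4, and 4 (3/4)^3 = 27/16. *)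
Lemma threshold_gt1 {R : realType} : 1 < 4 * expR (- (3 / 4)) :> R.
Proof.
have -> : - (3 / 4) = 3%:R * - (1 / 4) :> R by lra.
rewrite expRM_natl.
have e : 3 / 4 <= expR (- (1 / 4)) :> R.
  by apply: le_trans (expR_ge1Dx _); lra.
have := lerXn2r 3 _ _ e; rewrite !nnegrE expR_ge0 => /(_ _ isT).
have -> : 0 <= 3 / 4 :> R by lra.
move=> /(_ isT); have -> : (3 / 4) ^+ 3 = 27 / 64 :> R by field.
lra.
Qed.

Definition seg_pt {R : realType} {a b : R} (x : R) (xab : x \in `[a, b]) :
  seg a b := exist _ x (mem_set xab).

Lemma node0_in {R : realType} : (0 : R) \in `[0, 1 / 2].
Proof. by rewrite in_itv/=; lra. Qed.

Lemma node1_in {R : realType} : (1 / 4 : R) \in `[0, 1 / 2].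
Proof. by rewrite in_itv/=; lra. Qed.

Lemma node2_in {R : realType} : (1 / 2 : R) \in `[0, 1 / 2].
Proof. by rewrite in_itv/=; lra. Qed.

Lemma one_in {R : realType} : (1 : R) \in `[0, 2].
Proof. by rewrite in_itv/=; lra. Qed.

(** The weight exp(s^2) of the node s turns the kernel function
    exp(-(t-s)^2) into exp(-t^2) exp(2st); the signs 1, -2, 1 then make the
    sum a perfect square. *)
Definition nodes {R : realType} : seq (R * seg (0 : R) (1 / 2)) :=
  [:: (1, seg_pt node0_in); (- 2 * expR (1 / 16), seg_pt node1_in);
      (expR (1 / 4), seg_pt node2_in)].

Lemma bump_nodes {R : realType} (t : R) :
  \sum_(p <- nodes) p.1 * kappa (t - \val p.2) = bump t.
Proof.
rewrite /nodes !big_cons big_nil /= /kappa /bump addr0.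
rewrite subr0.
have e1 : expR (1 / 16) * expR (- (t - 1 / 4) ^+ 2) =
    expR (- t ^+ 2) * expR (t / 2).
  by rewrite -!expRD; congr expR; field.
have e2 : expR (1 / 4) * expR (- (t - 1 / 2) ^+ 2) =
    expR (- t ^+ 2) * expR (t / 2) ^+ 2.
  by rewrite -expRM_natl -!expRD; congr expR; field.
by rewrite -[X in _ + (X + _)]mulrA e1 e2; ring.
Qed.

(** * Operator norms and minimal-norm extensions *)
Section OperatorNorm.
Context {R : realType} {E F : normedModType R}.

Lemma ratio_le_opnorm (M : {linear E -> F}) (f : E) : f != 0 ->
  ((`|M f| / `|f|)%:E <= opnorm M)%E.
Proof.
move=> f0; apply: ereal_sup_ubound; exists (`|f|^-1 *: f).
  by rewrite /= normrZ normfV normr_id mulVf ?normr_eq0.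
by rewrite linearZ normrZ normfV normr_id mulrC.
Qed.

Lemma opnorm_le1 (M : {linear E -> F}) (f : E) : (opnorm M <= 1)%E ->
  `|M f| <= `|f|.
Proof.
have [-> _|f0 M1] := eqVneq f 0; first by rewrite linear0 !normr0.
have := le_trans (ratio_le_opnorm M f0) M1.
by rewrite lee_fin ler_pdivrMr ?normr_gt0// mul1r.
Qed.

End OperatorNorm.

Section MinimalNorm.
Context {R : realType} {T S : Type} (i : S -> T) {k : T -> T -> R}.
Context (WX : rkhs k) (WY : rkhs (fun t s => k (i t) (i s))).

Lemma rkhs_dotC (f h : WX) : rkhs_dot WX f h = rkhs_dot WX h f.
Proof. by have := hermC (rkhs_dot WX) f h; rewrite expr0 mul1r. Qed.

(** If every extension h has the same inner product with f as f itself, then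
    h - f is orthogonal to f, and Pythagoras makes f the unique minimizer. *)
Lemma min_norm_extension_eq (g : WY) (f : WX) : is_extension g f ->
  (forall h : WX, is_extension g h -> rkhs_dot WX h f = rkhs_dot WX f f) ->
  min_norm_extension i WX WY g = f.
Proof.
move=> gf orth.
have pyth (h : WX) : is_extension g h ->
    `|h| ^+ 2 = `|f| ^+ 2 + `|h - f| ^+ 2.
  move=> /orth hf; rewrite -!rkhs_normE.
  have -> : rkhs_dot WX (h - f) (h - f) = rkhs_dot WX h h - rkhs_dot WX h f -
      (rkhs_dot WX f h - rkhs_dot WX f f) by rewrite linearBl !linearBr.
  by rewrite (rkhs_dotC f h) hf; ring.
have fmin : is_min_norm_extension g f.
  split=> // h /pyth hp; rewrite -(@ler_pXn2r _ 2)// ?nnegrE// hp.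
  by rewrite lerDl sqr_ge0.
rewrite /min_norm_extension; case: xgetP => [h _ [gh hmin]|/(_ f)//].
apply/eqP; rewrite -subr_eq0 -normr_le0.
have := hmin f gf; rewrite -(@ler_pXn2r _ 2)// ?nnegrE// (pyth h gh).
rewrite gerDl => hf0; rewrite -(@ler_pXn2r _ 2)// ?nnegrE//.
by rewrite expr0n.
Qed.

(** The inner product of h with a combination of kernel functions with nodes
    in S is the same combination of values of h on S, so it depends only on
    the restriction of h. *)
Lemma min_norm_extension_sections (c : seq (R * S)) :
  min_norm_extension i WX WY (\sum_(p <- c) p.1 *: rkhs_section WY p.2) =
  \sum_(p <- c) p.1 *: rkhs_section WX (i p.2).
Proof.
have fext : is_extension (\sum_(p <- c) p.1 *: rkhs_section WY p.2)
    (\sum_(p <- c) p.1 *: rkhs_section WX (i p.2)).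
  apply/funext => s /=; rewrite !linear_sum !fct_sumE.
  by apply: eq_bigr => p _; rewrite !linearZ /= /GRing.scale /= !rkhs_sectionE.
apply: min_norm_extension_eq => // h hext.
have sum_dot (u : WX) :
    rkhs_dot WX u (\sum_(p <- c) p.1 *: rkhs_section WX (i p.2)) =
    \sum_(p <- c) p.1 * rkhs_fun WX u (i p.2).
  rewrite linear_sumr; apply: eq_bigr => p _.
  by rewrite linearZr rkhs_reproducing.
rewrite !sum_dot; apply: eq_bigr => p _; congr (_ * _).
by rewrite -[LHS]/((rkhs_fun WX h \o i) p.2) hext -fext.
Qed.

End MinimalNorm.

Lemma bump_continuous {R : realType} : continuous (@bump R).
Proof.
have -> : @bump R = (fun t =>
    expR (- (t * t)) * ((expR (t / 2) - 1) * (expR (t / 2) - 1))).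
  by apply/funext => t; rewrite /bump !expr2.
have chalf : continuous (fun t : R => expR (t / 2) - 1).
  move=> t; apply: cvgB; last exact: cvg_cst.
  apply: (continuous_cvg _ (@continuous_expR R _)).
  by apply: cvgMr_tmp; exact: cvg_id.
move=> t; apply: cvgM; last by apply: cvgM; exact: chalf.
apply: (continuous_cvg _ (@continuous_expR R _)).
by apply: cvgN; apply: cvgM; exact: cvg_id.
Qed.

Lemma bump_seg_continuous {R : realType} (a b : R) :
  continuous (fun t : seg a b => bump (\val t)).
Proof.
move=> t; apply: continuous_comp; last exact: bump_continuous.
exact: initial_continuous.
Qed.

Definition bump_on {R : realType} (a b : R) : Cseg a b :=
  mkCseg (@bump_seg_continuous R a b).

Lemma bump_on_norm_le {R : realType} : `|bump_on 0 (1 / 2 : R)| <= bump (1 / 2).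
Proof.
apply: supnorm_le => [|t]; first exact: bump_ge0.
rewrite ger0_norm ?bump_ge0//; apply: bump_le_half.
by have := set_valP t; rewrite /= in_itv.
Qed.

Lemma Cseg_le_norm {R : realType} (a b : R) (f : Cseg a b) (t : seg a b) :
  `|f t| <= `|f|.
Proof. exact: supnorm_ub. Qed.

(** The test function is bump on I, the image in the larger space being bump
    on [0,2], evaluated at 1. *)
Lemma opnorm_extension_ge {R : realType}
    (k : seg (0 : R) 2 -> seg (0 : R) 2 -> R)
    (kE : forall t s, k t s = kappa (\val t - \val s))
    (WX : rkhs k) (WY : rkhs (fun t s => k (inclI R t) (inclI R s)))
    (M : {linear CI R -> CT R}) :
  (forall (f : CI R) (g : WY), f =1 rkhs_fun WY g ->
     M f =1 rkhs_fun WX (min_norm_extension (inclI R) WX WY g)) ->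
  ((4 * expR (- (3 / 4)))%:E <= opnorm M)%E.
Proof.
move=> Mext; set f := bump_on 0 (1 / 2 : R).
set g : WY := \sum_(p <- nodes) p.1 *: rkhs_section WY p.2.
have fg : f =1 rkhs_fun WY g.
  move=> t; rewrite /g linear_sum fct_sumE -[f t]bump_nodes.
  apply: eq_bigr => p _.
  by rewrite linearZ /= /GRing.scale /= rkhs_sectionE kE.
pose t1 : seg (0 : R) 2 := seg_pt one_in.
have Mf1 : M f t1 = bump 1.
  rewrite (Mext _ _ fg) min_norm_extension_sections linear_sum fct_sumE.
  rewrite -[RHS]bump_nodes; apply: eq_bigr => p _.
  by rewrite linearZ /= /GRing.scale /= rkhs_sectionE kE.
have fpos : 0 < `|f|.
  apply: lt_le_trans (Cseg_le_norm f (seg_pt node2_in)).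
  by rewrite normr_gt0 gt_eqF// bump_half_gt0.
apply: le_trans (ratio_le_opnorm M _); last by rewrite -normr_gt0; exact: fpos.
rewrite lee_fin ler_pdivlMr//.
apply: (@le_trans _ _ (bump 1)); last first.
  by rewrite -Mf1; apply: le_trans (ler_norm _) _; exact: Cseg_le_norm.
by apply: le_trans bump_1_ge; rewrite ler_wpM2l ?bump_on_norm_le.
Qed.

(** * Bochner integrals and contractive functionals *)

Lemma finite_range_sum {R : realType} {T : Type} {E : choiceType}
    (s : T -> E) (finS : finite_set (range s)) (l : E -> R) (w : T) :
  l (s w) = \sum_(y <- finmap.enum_fset (fset_set (range s)))
              l y * \1_(s @^-1` [set y]) w.
Proof.
set r := finmap.enum_fset _.
have sr : s w \in r by rewrite in_fset_set// inE; exists w.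
rewrite (bigD1_seq (s w) sr) ?finmap.fset_uniq//= indicE mem_set//= mulr1.
rewrite big1 ?addr0// => y /eqP ys; rewrite indicE memNset ?mulr0// => sy.
by apply: ys; rewrite -sy.
Qed.

Lemma contraction_continuous {R : realType} {E F : normedModType R}
  (l : {linear E -> F}) : (forall x, `|l x| <= `|x|) -> continuous l.
Proof.
move=> l1 x; apply/cvgrPdist_lt => e e0.
near=> y; rewrite -linearB; apply: le_lt_trans (l1 _) _.
by near: y; exact: (@cvgr_dist_lt _ _ _ _ _ id x cvg_id).
Unshelve. all: by end_near. Qed.

Section BochnerFunctionals.
Context {R : realType} {d : measure_display} {Omega : measurableType d}.
Context (P : probability Omega R) {E : normedModType R}.

Lemma continuous_borel_measurable (g : E -> R) : continuous g ->
  measurable_fun [set: borel E] (g : borel E -> R).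
Proof.
move=> /continuousP cg; apply: (measurability _ (RGenOpens.measurableE R)).
move=> _ [_ [a [b ->] <-]]; rewrite setTI.
by apply: sub_sigma_algebra; apply: cg; exact: interval_open.
Qed.

Lemma random_element_comp (f : Omega -> E) (g : E -> R) :
  random_element f -> continuous g -> measurable_fun [set: Omega] (g \o f).
Proof.
move=> mf cg; apply: (measurableT_comp (f := (g : borel E -> R))) mf.
exact: continuous_borel_measurable.
Qed.

(** Covers differences f - s with s simple; addition of two measurable
    functions into a nonseparable space need not be measurable. *)
Lemma simple_element_measurable (s : Omega -> E) (G : Omega -> E -> R) :
  simple_element s ->
  (forall y, measurable_fun [set: Omega] (G ^~ y)) ->
  measurable_fun [set: Omega] (fun w => G w (s w)).
Proof.
move=> [finS mS] mG _ B mB; rewrite setTI.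
have -> : (fun w => G w (s w)) @^-1` B =
    \bigcup_(y in range s) (s @^-1` [set y] `&` G ^~ y @^-1` B).
  apply/seteqP; split=> [w Bw|w [y _ [/= <-]]//].
  by exists (s w); [exists w|].
apply: fin_bigcup_measurable => // y _; apply: measurableI => //.
by rewrite -[X in measurable X]setTI; exact: mG.
Qed.

Lemma simple_functional_integral (A : set Omega) (s : Omega -> E)
    (l : {linear E -> R^o}) : measurable A -> simple_element s ->
  P.-integrable A (EFin \o (l \o s)) /\
  \int[P]_(w in A) l (s w) = l (simple_integral P A s).
Proof.
move=> mA [finS mS]; set r := finmap.enum_fset (fset_set (range s)).
have lsE w := finite_range_sum finS l w.
have iterm y :
    P.-integrable A (fun w => (l y * \1_(s @^-1` [set y]) w)%:E).
  apply: (integrableS measurableT) => //.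
  under eq_fun do rewrite EFinM.
  exact: integrableZl (integrable_indic P (mS y)).
have lsE' : EFin \o (l \o s) =
    (fun w => \sum_(y <- r) (l y * \1_(s @^-1` [set y]) w)%:E)%E.
  by apply/funext => w; rewrite /= lsE sumEFin.
split; first by rewrite lsE'; apply: integrable_sum => //= y _; exact: iterm.
have intE y : (\int[P]_(w in A) (l y * \1_(s @^-1` [set y]) w)%:E)%E =
    (l y * fine (P (A `&` s @^-1` [set y])))%:E.
  under eq_integral do rewrite EFinM.
  rewrite integralZl//; last exact: integrableS (integrable_indic P (mS y)).
  by rewrite integral_indic// setIC EFinM fineK// fin_num_measure//;
    exact: measurableI.
rewrite /Rintegral -/(EFin \o (l \o s)) lsE' integral_sum//.
under eq_bigr do rewrite intE.
rewrite sumEFin /= /simple_integral fsbig_finite//= linear_sum.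
by apply: eq_bigr => y _; rewrite linearZ /= /GRing.scale /= mulrC.
Qed.

(** Both sides are the limit of the integrals of l (s n) along the simple
    functions s n that define the Bochner integral. *)
Lemma bochner_functional (A : set Omega) (f : Omega -> E) (v : E)
    (l : {linear E -> R^o}) : measurable A -> (forall x, `|l x| <= `|x|) ->
  has_bochner_integral P A f v ->
  P.-integrable A (EFin \o (l \o f)) /\
  \int[P]_(w in A) l (f w) = l v.
Proof.
move=> mA l1 [mf [s [ss fs sv]]].
have cl := contraction_continuous l1.
have mlf : measurable_fun A (l \o f).
  by apply: measurable_funTS; exact: random_element_comp.
have mlfs n : measurable_fun A (fun w => l (f w - s n w)).
  apply: measurable_funTS.
  apply: (simple_element_measurable (G := fun w y => l (f w - y)) (ss n)) => y.
  apply: (random_element_comp (g := fun x => l (x - y)) mf) => x.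
  by under eq_fun do rewrite linearB; apply: cvgB; [exact: cl|exact: cvg_cst].
have mfs n : measurable_fun A (fun w => `|f w - s n w|).
  apply: measurable_funTS.
  apply: (simple_element_measurable (G := fun w y => `|f w - y|) (ss n)) => y.
  apply: (random_element_comp (g := fun x => `|x - y|) mf) => x.
  by apply: cvg_norm; apply: cvgB; [exact: cvg_id|exact: cvg_cst].
move: fs => /fine_cvgP[fsfin fscvg].
have ifs n : (\int[P]_(w in A) `|f w - s n w|%:E)%E \is a fin_num ->
    P.-integrable A (fun w => `|f w - s n w|%:E).
  move=> h; apply/integrableP; split; first exact/measurable_EFinP.
  under eq_integral do rewrite gee0_abs//.
  by rewrite ltey_eq h.
have ilfs n : (\int[P]_(w in A) `|f w - s n w|%:E)%E \is a fin_num ->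
    P.-integrable A (fun w => (l (f w - s n w))%:E).
  move=> /ifs; apply: le_integrable => //; first exact/measurable_EFinP.
  by move=> w _; rewrite /= lee_fin normr_id.
have ilf : P.-integrable A (EFin \o (l \o f)).
  have [n _ /(_ n (leqnn n)) nfin] := fsfin.
  have [ils _] := simple_functional_integral l mA (ss n).
  rewrite (_ : _ \o _ = (EFin \o (l \o s n)) \+ (fun w => (l (f w - s n w))%:E))%E.
    by apply: integrableD => //; exact: ilfs.
  by apply/funext => w; rewrite /= linearB /= -EFinD addrC subrK.
split=> //.
apply/eqP; rewrite -subr_eq0 -normr_le0; apply/ler_addgt0Pr => e e0.
rewrite add0r.
have e2 : 0 < e / 2 by rewrite divr_gt0.
near \oo => n.
have nfin : (\int[P]_(w in A) `|f w - s n w|%:E)%E \is a fin_num.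
  by near: n.
have [ils lsE] := simple_functional_integral l mA (ss n).
have dv : `|v - simple_integral P A (s n)| < e / 2.
  by near: n; exact: cvgr_dist_lt.
have df : \int[P]_(w in A) `|f w - s n w| < e / 2.
  have : `|0 - \int[P]_(w in A) `|f w - s n w| | < e / 2.
    by near: n; exact: cvgr_dist_lt.
  by rewrite sub0r normrN ger0_norm// Rintegral_ge0.
have near_f : `|\int[P]_(w in A) l (f w) - l (simple_integral P A (s n))| <=
    e / 2.
  rewrite -lsE -RintegralB//; under eq_Rintegral do rewrite -linearB.
  apply: le_trans (le_normr_Rintegral mA (ilfs n nfin)) _.
  apply: le_trans (ltW df); apply: le_Rintegral => //; last exact: ifs.
  exact/integrable_norm/ilfs.
have near_v : `|l (simple_integral P A (s n)) - l v| <= e / 2.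
  by rewrite -linearB; apply: le_trans (l1 _) _; rewrite distrC ltW.
by rewrite (splitr e); apply: le_trans (ler_distD _ _ _) (lerD near_f near_v).
Unshelve. all: by end_near. Qed.

End BochnerFunctionals.

(** * Evaluation, restriction and simple approximation *)

Lemma borel_measurable_comp {R : realType} {d : measure_display}
    {Omega : measurableType d} {E F : normedModType R}
    (f : Omega -> E) (g : E -> F) :
  random_element f -> continuous g -> random_element (g \o f).
Proof.
move=> mf /continuousP cg.
have mg : measurable_fun [set: borel E] (g : borel E -> borel F).
  apply: (@measurability _ _ _ (borel F) _ _ (@open F)) => // _ [B oB <-].
  by rewrite setTI; apply: sub_sigma_algebra; exact: cg.
exact: (measurableT_comp mg mf).
Qed.

Definition eval_at {R : realType} {a b : R} (t : seg a b) (f : Cseg a b) : R^o :=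
  f t.

HB.instance Definition _ {R : realType} {a b : R} (t : seg a b) :=
  @GRing.isLinear.Build R (Cseg a b) R^o _ (eval_at t) (fun k f g => erefl).

Lemma restr_is_linear {R : realType} {a b c d : R} (ca : c <= a) (bd : b <= d) :
  linear (restr ca bd).
Proof. by move=> k f g; apply: CsegP. Qed.

HB.instance Definition _ {R : realType} {a b c d : R} (ca : c <= a) (bd : b <= d) :=
  @GRing.isLinear.Build R (Cseg c d) (Cseg a b) _ (restr ca bd)
    (restr_is_linear ca bd).

Lemma restr_norm_le {R : realType} {a b c d : R} (ca : c <= a) (bd : b <= d)
  (f : Cseg c d) : `|restr ca bd f| <= `|f|.
Proof. by apply: supnorm_le => // t; exact: (Cseg_le_norm f (seg_incl ca bd t)). Qed.

Section SimpleApproximation.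
Import HBNNSimple.

(** The positive and negative parts are approximated from below, so that g n
    is dominated by v; this makes L^2 convergence available. *)
Lemma bounded_simple_approximation {R : realType} {d : measure_display}
    {T : measurableType d} (v : T -> R) : measurable_fun [set: T] v ->
  exists g : nat -> T -> R,
    [/\ forall n, finite_set (range (g n)),
        forall n, measurable_fun [set: T] (g n),
        forall n x, `|g n x| <= `|v x| &
        forall x, g n x @[n --> \oo] --> v x].
Proof.
move=> mv.
pose p x := Num.max (v x) 0; pose q x := Num.max (- v x) 0.
have pqE x : p x - q x = v x by rewrite /p /q !maxEle; case: ifP; case: ifP; lra.
have mp : measurable_fun [set: T] (EFin \o p).
  by apply/measurable_EFinP; exact: measurable_maxr.
have mq : measurable_fun [set: T] (EFin \o q).
  apply/measurable_EFinP; apply: measurable_maxr => //.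
  exact: measurable_funN.
have p0 x : [set: T] x -> (0 <= (EFin \o p) x)%E.
  by move=> _; rewrite lee_fin le_max lexx orbT.
have q0 x : [set: T] x -> (0 <= (EFin \o q) x)%E.
  by move=> _; rewrite lee_fin le_max lexx orbT.
pose gp := nnsfun_approx measurableT mp; pose gq := nnsfun_approx measurableT mq.
have gp_le n x : gp n x <= p x.
  by rewrite -lee_fin /gp nnsfun_approxE; exact: le_approx.
have gq_le n x : gq n x <= q x.
  by rewrite -lee_fin /gq nnsfun_approxE; exact: le_approx.
exists (fun n x => gp n x - gq n x); split.
- move=> n; apply: (@sub_finite_set _ _ [set x - y | x in range (gp n) & y in range (gq n)]).
    by move=> _ [x _ <-]; exists (gp n x); [exists x|exists (gq n x); [exists x|]].
  by apply: finite_image2; exact: fimfunP.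
- by move=> n; apply: measurable_funB; exact: measurable_funPT.
- move=> n x; move: (gp_le n x) (gq_le n x).
  have : 0 <= gp n x by exact: fun_ge0.
  have : 0 <= gq n x by exact: fun_ge0.
  rewrite /p /q ler_norml !maxEle.
  by have [v0|v0] := ger0P (v x); case: ifP; case: ifP; lra.
- move=> x; rewrite -pqE; apply: cvgB.
    by have /fine_cvgP[] := cvg_nnsfun_approx measurableT mp p0 (x := x) I.
  by have /fine_cvgP[] := cvg_nnsfun_approx measurableT mq q0 (x := x) I.
Qed.

End SimpleApproximation.

(** * Moments of X against functions of Y are fixed by M *)

Section FixedMoments.
Context {R : realType} {d : measure_display} {Omega : measurableType d}.
Context (P : probability Omega R) (X : Omega -> CT R).
Context (M : {linear CI R -> CT R}).

(** u = E[phi X], tested pointwise, which suffices for continuous functions. *)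
Definition weak_moment (phi : Omega -> R) (u : CT R) := forall t,
  P.-integrable [set: Omega] (fun w => (phi w * X w t)%:E) /\
  \int[P]_w (phi w * X w t) = u t.

(** This property passes from indicators of events of Y to simple functions of
    Y by linearity of M. *)
Definition fixed_moment (phi : Omega -> R) :=
  exists u : CT R, M (restrI R u) = u /\ weak_moment phi u.

Lemma fixed_moment_lincomb (I : Type) (r : seq I) (c : I -> R)
    (phi : I -> Omega -> R) : (forall i, fixed_moment (phi i)) ->
  fixed_moment (fun w => \sum_(i <- r) c i * phi i w).
Proof.
move=> /choice[u uP]; exists (\sum_(i <- r) c i *: u i); split.
  rewrite !linear_sum; apply: eq_bigr => i _.
  by rewrite !linearZ; congr (_ *: _); exact: (uP i).1.
move=> t.
have iterm i : P.-integrable [set: Omega] (fun w => (c i * (phi i w * X w t))%:E).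
  under eq_fun do rewrite EFinM.
  by apply: integrableZl => //; exact: ((uP i).2 t).1.
have sumE w : ((\sum_(i <- r) c i * phi i w) * X w t)%:E =
    (\sum_(i <- r) (c i * (phi i w * X w t))%:E)%E.
  by rewrite mulr_suml sumEFin; under eq_bigr do rewrite -mulrA.
split; first by under eq_fun do rewrite sumE; exact: integrable_sum.
rewrite /Rintegral; under eq_integral do rewrite sumE.
rewrite integral_sum//.
have intE i : (\int[P]_w (c i * (phi i w * X w t))%:E)%E = (c i * u i t)%:E.
  have [ii <-] := (uP i).2 t.
  under eq_integral do rewrite EFinM.
  by rewrite integralZl// EFinM /Rintegral fineK// integrable_fin_num.
under eq_bigr do rewrite intE.
rewrite sumEFin /= -[RHS]/(eval_at t _) linear_sum.
by apply: eq_bigr => i _; rewrite linearZ.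
Qed.

Context (Mcontr : forall f : CI R, `|M f| <= `|f|).
Context (mX : random_element X).
Let Y : Omega -> CI R := fun w => restrI R (X w).

(** The Bochner integral v of X over A is also that of the conditional
    expectation Z, so v(t) is the integral over A of M(Y)(t) = l(X), where l is
    the contractive functional f |-> M(f|_I)(t); hence v(t) = l(v). *)
Lemma fixed_moment_indic (Z : Omega -> CT R) (A : set Omega) :
  is_cond_exp P X Y Z -> {ae P, forall w, M (Y w) = Z w} ->
  sigma_gen Y A -> fixed_moment \1_A.
Proof.
move=> [_ XZ] MYZ sA.
have cres : continuous (restrI R).
  by apply: contraction_continuous => f; exact: restr_norm_le.
have mY : random_element Y by exact: (borel_measurable_comp mX cres).
have mA : measurable A by case: sA => B mB <-; exact: mY.
have [v [Xv Zv]] := XZ _ sA.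
have eval1 (t : seg (0 : R) 2) (f : CT R) : `|eval_at t f| <= `|f|.
  exact: Cseg_le_norm.
have indicM (f : Omega -> R) w : \1_A w * f w = (f \_ A) w.
  by rewrite patchE indicE; case: ifP; rewrite ?mul1r ?mul0r.
exists v; split; last first.
  move=> t; have [iX XE] := bochner_functional mA (eval1 t) Xv.
  under eq_fun do rewrite (indicM (fun w => X w t)).
  split; first by move: iX; rewrite integrable_mkcond// restrict_EFin.
  under eq_Rintegral do rewrite (indicM (fun w => X w t)).
  by rewrite -Rintegral_mkcond XE.
apply: CsegP => t; pose l : {linear CT R -> R^o} := eval_at t \o (M \o restrI R).
have l1 f : `|l f| <= `|f|.
  apply: le_trans (eval1 t _) _; apply: le_trans (Mcontr _) _.
  exact: restr_norm_le.
have [il lE] := bochner_functional mA l1 Xv.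
have [iZ ZE] := bochner_functional mA (eval1 t) Zv.
rewrite -[LHS]/(l v) -lE -[RHS]/(eval_at t v) -ZE /Rintegral; congr fine.
apply: ae_eq_integral => //; [exact: measurable_int il|exact: measurable_int iZ|].
by apply: filterS MYZ => w MYw _; rewrite /l/= MYw.
Qed.

Lemma fixed_moment_simple (Z : Omega -> CT R) (g : borel (CI R) -> R) :
  is_cond_exp P X Y Z -> {ae P, forall w, M (Y w) = Z w} ->
  finite_set (range g) -> measurable_fun [set: borel (CI R)] g ->
  fixed_moment (fun w => g (Y w)).
Proof.
move=> XYZ MYZ fing mg.
under eq_fun do rewrite (finite_range_sum fing id).
apply: fixed_moment_lincomb => y.
have -> : (fun w => \1_(g @^-1` [set y]) (Y w)) = \1_(Y @^-1` (g @^-1` [set y])).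
  by move=> *; apply/funext => w; rewrite !indicE.
apply: (fixed_moment_indic XYZ MYZ).
exists (g @^-1` [set y]); last by rewrite setTI.
by rewrite -[X in measurable X]setTI; exact: mg.
Qed.

End FixedMoments.

(** * Second moments *)

Section SecondMoments.
Context {R : realType} {d : measure_display} {Omega : measurableType d}.
Context (P : probability Omega R) (X : Omega -> CT R).
Context (mX : random_element X).
Context (kX : forall t s, cov_kernel P X t s = kappa (\val t - \val s)).

Lemma measurable_eval t : measurable_fun [set: Omega] (fun w => X w t).
Proof.
apply: (random_element_comp (g := eval_at t) mX).
by apply: contraction_continuous => f; exact: Cseg_le_norm.
Qed.

(** As an infinite integral has real value 0, the value 1 also makes X_t
    square integrable. *)
Lemma variance1 t : \int[P]_w (X w t * X w t) = 1.
Proof.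
by have := kX t t; rewrite /cov_kernel subrr /kappa expr0n oppr0 expR0.
Qed.

Lemma integrable_sqr t :
  P.-integrable [set: Omega] (fun w => (X w t * X w t)%:E).
Proof.
have m2 : measurable_fun [set: Omega] (fun w => X w t * X w t).
  by apply: measurable_funM; exact: measurable_eval.
apply/integrableP; split; first exact/measurable_EFinP.
under eq_integral do rewrite gee0_abs ?lee_fin -?expr2 ?sqr_ge0//.
rewrite ltey; apply/eqP => Ey; have := variance1 t; rewrite /Rintegral.
under eq_integral do rewrite -expr2.
by rewrite Ey /= => /eqP; rewrite eq_sym oner_eq0.
Qed.

Lemma integrable_prod t s :
  P.-integrable [set: Omega] (fun w => (X w t * X w s)%:E).
Proof.
have i2 := integrableD measurableT (integrable_sqr t) (integrable_sqr s).
apply: le_integrable i2 => //.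
  by apply/measurable_EFinP; apply: measurable_funM; exact: measurable_eval.
move=> w _; rewrite -EFinD /= lee_fin ler_norml.
set a := X w t; set b := X w s.
have ab0 : 0 <= a * a + b * b by rewrite -!expr2 addr_ge0 ?sqr_ge0.
by rewrite ger0_norm//; nra.
Qed.

(** The variable V whose covariance with X_t is bump t. *)
Definition node_sum (w : Omega) : R :=
  \sum_(p <- nodes) p.1 * X w (inclI R p.2).

Lemma node_sum_moment (phi : Omega -> R) :
  (forall t, P.-integrable [set: Omega] (fun w => (phi w * X w t)%:E)) ->
  P.-integrable [set: Omega] (fun w => (phi w * node_sum w)%:E) /\
  \int[P]_w (phi w * node_sum w) =
    \sum_(p <- nodes) p.1 * \int[P]_w (phi w * X w (inclI R p.2)).
Proof.
move=> iphi.
have sumE w : (phi w * node_sum w)%:E =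
    (\sum_(p <- nodes) (p.1 * (phi w * X w (inclI R p.2)))%:E)%E.
  by rewrite mulr_sumr sumEFin; under eq_bigr do rewrite mulrCA.
have iterm (p : R * seg (0 : R) (1 / 2)) :
    P.-integrable [set: Omega] (fun w => (p.1 * (phi w * X w (inclI R p.2)))%:E).
  by under eq_fun do rewrite EFinM; exact: integrableZl.
split; first by under eq_fun do rewrite sumE; exact: integrable_sum.
rewrite /Rintegral; under eq_integral do rewrite sumE.
rewrite (integral_sum measurableT iterm).
have intE (p : R * seg (0 : R) (1 / 2)) :
    (\int[P]_w (p.1 * (phi w * X w (inclI R p.2)))%:E)%E =
    (p.1 * \int[P]_w (phi w * X w (inclI R p.2)))%:E.
  under eq_integral do rewrite EFinM.
  by rewrite integralZl// EFinM /Rintegral fineK// integrable_fin_num.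
by under eq_bigr do rewrite intE; rewrite sumEFin.
Qed.

Lemma integrable_node_eval t :
  P.-integrable [set: Omega] (fun w => (node_sum w * X w t)%:E).
Proof.
under eq_fun do rewrite mulrC.
exact: (node_sum_moment (integrable_prod t)).1.
Qed.

Lemma node_sum_eval t : \int[P]_w (node_sum w * X w t) = bump (\val t).
Proof.
under eq_Rintegral do rewrite mulrC.
rewrite (node_sum_moment (integrable_prod t)).2 -bump_nodes.
by apply: eq_bigr => p _; congr (_ * _); exact: kX.
Qed.

Lemma integrable_node_sqr :
  P.-integrable [set: Omega] (fun w => (node_sum w * node_sum w)%:E).
Proof. exact: (node_sum_moment integrable_node_eval).1. Qed.

Lemma measurable_node_sum : measurable_fun [set: Omega] node_sum.
Proof.
apply: measurable_sum => p; apply: measurable_funM => //.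
exact: measurable_eval.
Qed.

(** A quantitative Cauchy-Schwarz inequality: with D = phi - V one has
    |D X_t| <= (D^2 / e + e X_t^2) / 2, and X_t has variance 1. The bound is
    uniform in t. *)
Lemma moment_dist (phi : Omega -> R) (t : seg (0 : R) 2) (e : R) : 0 < e ->
  P.-integrable [set: Omega] (fun w => (phi w * X w t)%:E) ->
  P.-integrable [set: Omega]
    (fun w => ((phi w - node_sum w) * (phi w - node_sum w))%:E) ->
  \int[P]_w ((phi w - node_sum w) * (phi w - node_sum w)) <= e ^+ 2 ->
  `|\int[P]_w (phi w * X w t) - bump (\val t)| <= e.
Proof.
move=> e0 iphi i2 D2.
have iD : P.-integrable [set: Omega] (fun w => ((phi w - node_sum w) * X w t)%:E).
  under eq_fun do rewrite mulrBl EFinB.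
  exact: (integrableB measurableT iphi (integrable_node_eval t)).
rewrite -node_sum_eval -RintegralB//; last exact: integrable_node_eval.
under eq_Rintegral do rewrite -mulrBl.
apply: le_trans (le_normr_Rintegral measurableT iD) _.
have i2e : P.-integrable [set: Omega] (fun w => (e^-1 / 2 *
    ((phi w - node_sum w) * (phi w - node_sum w)))%:E).
  by under eq_fun do rewrite EFinM; exact: integrableZl.
have iXe : P.-integrable [set: Omega] (fun w => (e / 2 * (X w t * X w t))%:E).
  by under eq_fun do rewrite EFinM; apply: integrableZl => //; exact: integrable_sqr.
apply: (@le_trans _ _ (\int[P]_w (e^-1 / 2 *
    ((phi w - node_sum w) * (phi w - node_sum w)) + e / 2 * (X w t * X w t)))).
  apply: le_Rintegral => //; first exact: integrable_norm.
    exact: (integrableD measurableT i2e iXe).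
  move=> w _; rewrite normrM.
  set a := phi w - _; set b := X w t.
  have -> : a * a = `|a| ^+ 2 by rewrite real_normK ?num_real// expr2.
  have -> : b * b = `|b| ^+ 2 by rewrite real_normK ?num_real// expr2.
  rewrite -subr_ge0.
  have -> : e^-1 / 2 * `|a| ^+ 2 + e / 2 * `|b| ^+ 2 - `|a| * `|b| =
      e^-1 / 2 * (`|a| - e * `|b|) ^+ 2 by field; rewrite gt_eqF.
  by rewrite mulr_ge0 ?sqr_ge0// divr_ge0// invr_ge0 ltW.
rewrite RintegralD// !RintegralZl//; last exact: integrable_sqr.
rewrite variance1 mulr1 [leRHS](splitr e) lerD2r.
have -> : e / 2 = e^-1 / 2 * e ^+ 2 by field; rewrite gt_eqF.
by rewrite ler_wpM2l// divr_ge0// invr_ge0 ltW.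
Qed.

End SecondMoments.

(** * The absence of a contractive regression operator *)

(** V is a continuous function v of Y; approximate v by dominated simple
    functions on the Borel space of C(I), and conclude by dominated convergence
    with bound 4 V^2. *)
Lemma node_sum_approximation {R : realType} {d : measure_display}
    {Omega : measurableType d} (P : probability Omega R) (X : Omega -> CT R)
    (mX : random_element X)
    (kX : forall t s, cov_kernel P X t s = kappa (\val t - \val s)) (e : R) :
  0 < e -> exists g : borel (CI R) -> R,
    [/\ finite_set (range g), measurable_fun [set: borel (CI R)] g,
        P.-integrable [set: Omega] (fun w =>
          ((g (restrI R (X w)) - node_sum X w) *
           (g (restrI R (X w)) - node_sum X w))%:E) &
        \int[P]_w ((g (restrI R (X w)) - node_sum X w) *
          (g (restrI R (X w)) - node_sum X w)) <= e ^+ 2].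
Proof.
move=> e0; pose v (y : borel (CI R)) : R := \sum_(p <- nodes) p.1 * (y : CI R) p.2.
have mv : measurable_fun [set: borel (CI R)] v.
  apply: measurable_sum => p; apply: measurable_funM => //.
  apply: (continuous_borel_measurable (g := eval_at p.2)).
  by apply: contraction_continuous => f; exact: Cseg_le_norm.
have [g [fing mg gle gv]] := bounded_simple_approximation mv.
have mY : measurable_fun [set: Omega] (fun w => restrI R (X w) : borel (CI R)).
  apply: (borel_measurable_comp mX).
  by apply: contraction_continuous => f; exact: restr_norm_le.
pose D n w := g n (restrI R (X w)) - node_sum X w.
have mD n : measurable_fun [set: Omega] (D n).
  apply: measurable_funB; last exact: measurable_node_sum.
  exact: (measurableT_comp (mg n) mY).
have mDD n : measurable_fun [set: Omega] (fun w => (D n w * D n w)%:E).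
  by apply/measurable_EFinP; apply: measurable_funM.
have idom : P.-integrable [set: Omega]
    (fun w => (4 * (node_sum X w * node_sum X w))%:E).
  under eq_fun do rewrite EFinM.
  by apply: integrableZl => //; exact: integrable_node_sqr.
have dom n w : `|D n w * D n w| <= 4 * (node_sum X w * node_sum X w).
  have := gle n (restrI R (X w)); rewrite -[v _]/(node_sum X w) => h.
  rewrite ger0_norm -?expr2 ?sqr_ge0// -[leLHS]real_normK ?num_real//.
  rewrite -[X in 4 * X]real_normK ?num_real//.
  have -> : 4 * `|node_sum X w| ^+ 2 = (2 * `|node_sum X w|) ^+ 2 by ring.
  rewrite lerXn2r ?nnegrE ?mulr_ge0//.
  by apply: le_trans (ler_normB _ _) _; lra.
have Dcvg : {ae P, forall w, [set: Omega] w ->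
    (D n w * D n w)%:E @[n --> \oo] --> 0%E}.
  apply: aeW => w _; apply: cvg_EFin; first exact: nearW.
  have D0 : D n w @[n --> \oo] --> 0.
    by rewrite -(subrr (node_sum X w)); apply: cvgB; [exact: gv|exact: cvg_cst].
  by rewrite -(mulr0 0); exact: cvgM.
have Ddom : {ae P, forall w n, [set: Omega] w ->
    (`|(D n w * D n w)%:E| <= (4 * (node_sum X w * node_sum X w))%:E)%E}.
  by apply: aeW => w n _; rewrite lee_fin.
have [_ _] := dominated_convergence measurableT mDD (measurable_cst 0%E) Dcvg
  idom Ddom.
rewrite integral0 => /fine_cvgP[_ Dint].
have e2 : 0 < e ^+ 2 by rewrite exprn_gt0.
have [n _ /(_ n (leqnn n)) /=] := cvgr0_norm_lt _ Dint _ e2.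
rewrite -/(Rintegral _ _ _) => Dn.
exists (g n); split=> //.
  apply: le_integrable idom => //; first exact: mDD.
  by move=> w _; rewrite /= lee_fin (le_trans (dom n w))// ler_norm.
by apply: le_trans (ltW Dn); exact: ler_norm.
Qed.

(** For u = E[g(Y) X] with g(Y) close to V, contractivity and M(u|_I) = u bound
    u 1 by the sup norm of u on I; passing to the limit gives
    bump 1 <= bump (1/2). *)
Lemma no_contractive_regression {R : realType} {d : measure_display}
    {Omega : measurableType d} (P : probability Omega R) (X Z : Omega -> CT R)
    (M : {linear CI R -> CT R}) : random_element X ->
  (forall t s, cov_kernel P X t s = kappa (\val t - \val s)) ->
  (forall f : CI R, `|M f| <= `|f|) ->
  is_cond_exp P X (fun w => restrI R (X w)) Z ->
  ~ {ae P, forall w, M (restrI R (X w)) = Z w}.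
Proof.
move=> mX kX Mcontr XZ MYZ.
suff : bump 1 <= bump (1 / 2 : R).
  apply/negP; rewrite -ltNge; apply: lt_le_trans bump_1_ge.
  by rewrite -[ltLHS]mul1r ltr_pM2r ?bump_half_gt0// threshold_gt1.
apply/ler_addgt0Pr => e e0; have e2 : 0 < e / 2 by rewrite divr_gt0.
have [g [fing mg i2 D2]] := node_sum_approximation mX kX e2.
have [u [Mu um]] := fixed_moment_simple Mcontr mX XZ MYZ fing mg.
have udist t : `|u t - bump (\val t)| <= e / 2.
  by have [iphi <-] := um t; exact: (moment_dist mX kX e2 iphi i2 D2).
pose t1 : seg (0 : R) 2 := seg_pt one_in.
have u1 : bump 1 - e / 2 <= u t1.
  by have := udist t1; rewrite ler_norml => /andP[]; rewrite lerBrDl addrC.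
have unorm : u t1 <= `|restrI R u|.
  apply: le_trans (ler_norm _) _; apply: le_trans (Cseg_le_norm u t1) _.
  by rewrite -[X in `|X| <= _]Mu; exact: Mcontr.
have urest : `|restrI R u| <= bump (1 / 2) + e / 2.
  apply: supnorm_le => [|t]; first by rewrite addr_ge0 ?bump_ge0// ltW.
  have bt : bump (\val t) <= bump (1 / 2).
    by apply: bump_le_half; have := set_valP t; rewrite /= in_itv.
  rewrite -[X in `|X|](subrK (bump (\val t))) addrC.
  apply: le_trans (ler_normD _ _) _; rewrite ger0_norm ?bump_ge0// lerD//.
  exact: (udist (inclI R t)).
lra.
Qed.

Theorem mainTheorem3 (R : realType) (d : measure_display)
    (Omega : measurableType d) (P : probability Omega R)
    (X : Omega -> CT R)
    (gX : gaussian P X) (cX : centered P X)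
    (kX : forall t s, cov_kernel P X t s = kappa (\val t - \val s)) :
  let Y : Omega -> CI R := fun w => restrI R (X w) in
  [/\ forall (WX : rkhs (cov_kernel P X))
        (WY : rkhs (fun t s => cov_kernel P X (inclI R t) (inclI R s)))
        (M : {linear CI R -> CT R}),
        (forall (f : CI R) (g : WY), f =1 rkhs_fun WY g ->
           M f =1 rkhs_fun WX (min_norm_extension (inclI R) WX WY g)) ->
        ((4 * expR (- (3 / 4)))%:E <= opnorm M)%E,
      1 < 4 * expR (- (3 / 4)) :> R &
      ~ exists M : {linear CI R -> CT R},
          (exists Z : Omega -> CT R,
             is_cond_exp P X Y Z /\ {ae P, forall w, M (Y w) = Z w}) /\
          (opnorm M <= 1%:E)%E].
Proof.
move=> Y; split; [exact: opnorm_extension_ge|exact: threshold_gt1|].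
move=> [M [[Z [XZ MYZ]] M1]].
apply: (no_contractive_regression gX.1 kX _ XZ MYZ) => f.
exact: opnorm_le1.
Qed.
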